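(* Let $(a_n)$ be a weakly dense dli arithmetic sequence and let $(d_n)$ be the associated non-arithmetic sequence. Then the subgroup $t^{s}_{(d_n)}(\mathbb{T})$ cannot be characterized; that is, there is no sequence of integers $(u_n)$ such that $t^{s}_{(d_n)}(\mathbb{T})=t_{(u_n)}(\mathbb{T})$.
   Context: $\mathbb{N}=\{1,2,3,\dots\}$ and $\mathbb{T}=\mathbb{R}/\mathbb{Z}$ is the circle group. For $A\subseteq\mathbb{N}$, the natural density is $d(A)=\lim_{n\to\infty}\frac{|A\cap[0,n-1]|}{n}$ when the limit exists. For $A\subseteq\mathbb{N}$ and an integer $m\ge0$, $A-m=\{n\in\mathbb{N}: n=a-m\text{ for some }a\in A\}$. An arithmetic sequence is a sequence of positive integers $(a_n)_{n\ge 0}$ with $1=a_0<a_1<a_2<\dots$ and $a_n\mid a_{n+1}$ for every $n$. Its ratios are $b_n=a_n/a_{n-1}$ for $n\ge1$ (so $b_1=a_1$ and $b_n\ge 2$). The associated sequence $(d_n)_{n\ge1}$ is the increasing enumeration of the set $\{r a_k : k\ge 0,\ 1\le r<b_{k+1}\}$. Write $a_k=d_{n_k}$; thus $n_0=1$, $n_{k+1}-n_k=b_{k+1}-1$, and $d_{n_k+r-1}=ra_k$ for $1\le r\le b_{k+1}-1$. The lifting function $L:\mathcal{P}(\mathbb{N})\to\mathcal{P}(\mathbb{N})$ is $L(A)=\bigcup_{k\in A}[n_{k-1},n_k-1]$ (integer intervals). $(a_n)$ is weakly dense dli (weakly dense density lifting invariant) if for every infinite $K\subseteq\mathbb{N}$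 there exists an infinite $A\subseteq K$ such that $d(L(A-m))=0$ for each $m\in\mathbb{N}\cup\{0\}$. For a sequence of integers $(u_n)$, $t_{(u_n)}(\mathbb{T})=\{x\in\mathbb{T}: u_nx\to 0 \text{ in }\mathbb{T}\}$ and $t^s_{(u_n)}(\mathbb{T})=\{x\in\mathbb{T}: u_nx\to 0\text{ statistically in }\mathbb{T}\}$, where the latter means that for every $\varepsilon>0$, $d(\{n\in\mathbb{N}:\|u_nx\|\ge\varepsilon\})=0$, with $\|y\|$ the distance from $y$ to the nearest integer. *)

(* Defs.v *)
From HB Require Import structures.
From mathcomp Require Import all_boot all_order all_algebra zify.
From mathcomp Require Import all_classical all_reals all_analysis.

Set Implicit Arguments.
Unset Strict Implicit.
Unset Printing Implicit Defensive.

Import Order.TTheory GRing.Theory Num.Theory.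
Import numFieldNormedType.Exports.

Local Open Scope classical_set_scope.
Local Open Scope ring_scope.

Definition Zsub (R : realType) : {pred R} := [pred x | x \is a Num.int].

Fact Zsub_zmod_closed (R : realType) : zmod_closed (@Zsub R).
Proof. by split=> [|x y]; rewrite !inE ?rpred0 //; exact: rpredB. Qed.

HB.instance Definition _ (R : realType) :=
  GRing.isZmodClosed.Build R (@Zsub R) (@Zsub_zmod_closed R).

(* The quotient group R / Z, equipped below with the quotient topology. *)
Definition circle (R : realType) : Type := Quotient.quot (@Zsub R).

HB.instance Definition _ (R : realType) :=
  Quotient.copy (circle R) (Quotient.quot (@Zsub R)).
HB.instance Definition _ (R : realType) :=
  GRing.Zmodule.copy (circle R) (Quotient.quot (@Zsub R)).

Section circle_topology.
Context (R : realType).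
Local Notation piT := (\pi_(circle R)%qT : R -> circle R).

Definition circle_open (U : set (circle R)) := open (piT @^-1` U).

Fact circle_openT : circle_open setT.
Proof. by rewrite /circle_open preimage_setT; exact: openT. Qed.

Fact circle_openI : setI_closed circle_open.
Proof. by move=> A B; exact: openI. Qed.

Fact circle_open_bigU (I : Type) (f : I -> set (circle R)) :
  (forall i, circle_open (f i)) -> circle_open (\bigcup_i f i).
Proof. by move=> fo; apply: bigcup_open => i _; exact: fo. Qed.

HB.instance Definition _ := isOpenTopological.Build (circle R)
  circle_openT circle_openI circle_open_bigU.

End circle_topology.

(* Distance to the nearest integer; it does not depend on the representative
   chosen by [repr], see [dist_int_pi]. *)
Definition dist_int (R : realType) (y : circle R) : R :=
  inf [set `|repr y - m%:~R| | m in [set: int]].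

Lemma dist_int_pi (R : realType) (x : R) :
  dist_int (\pi_(circle R)%qT x) = inf [set `|x - m%:~R| | m in [set: int]].
Proof.
have /intrP[z Dz] : x - repr (\pi_(circle R)%qT x) \is a Num.int.
  by have := Quotient.idealrBE (@Zsub R) x (repr (\pi_(circle R)%qT x));
     rewrite reprK eqxx inE.
have Dx : repr (\pi_(circle R)%qT x) = x - z%:~R by rewrite -Dz opprB addrC subrK.
rewrite /dist_int Dx; congr inf; apply/seteqP; split => [_ [m _ <-]|_ [m _ <-]].
  by exists (z + m) => //; rewrite intrD opprD addrA.
by exists (m - z) => //; rewrite intrB opprB addrA subrK.
Qed.

(* The positive integers; a subset of them is a [set nat] not containing 0. *)
Definition pos_nat : set nat := [set n | (0 < n)%N].

(* [has_density A l]: the limit defining d(A) exists and equals l. *)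
Definition has_density (R : realType) (A : set nat) (l : R) : Prop :=
  #|[pred i : 'I_n | (i : nat) \in A]|%:R / n%:R @[n --> \oo] --> l.

Definition shift_down (A : set nat) (m : nat) : set nat :=
  [set n | pos_nat n /\ A (n + m)%N].

Definition arithmetic_seq (a : nat -> nat) : Prop :=
  [/\ a 0%N = 1%N, forall n, (a n < a n.+1)%N & forall n, (a n %| a n.+1)%N].

(* The ratios b_n = a_n / a_(n-1); only meaningful for n >= 1. *)
Definition seq_ratio (a : nat -> nat) (n : nat) : nat := (a n %/ a n.-1)%N.

Definition associated_set (a : nat -> nat) : set nat :=
  [set m | exists k r, (1 <= r < seq_ratio a k.+1)%N /\ m = (r * a k)%N].

(* [d] enumerates [S] increasingly with indices 1, 2, 3, ...;
   the value [d 0] is irrelevant. *)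
Definition increasing_enum (S : set nat) (d : nat -> nat) : Prop :=
  {in pos_nat &, forall i j, (i < j)%N -> (d i < d j)%N} /\ d @` pos_nat = S.

Definition associated_seq (a d : nat -> nat) : Prop :=
  increasing_enum (associated_set a) d.

(* The index n_k of a_k in the associated sequence: [associated_seq_idx] below
   shows d_(n_k + r - 1) = r a_k for 1 <= r < b_(k+1). *)
Fixpoint assoc_idx (a : nat -> nat) (k : nat) : nat :=
  if k is k'.+1 then (assoc_idx a k' + (seq_ratio a k'.+1).-1)%N else 1%N.

Section associated_seq_facts.
Local Open Scope nat_scope.

Lemma arith_gt0 a : arithmetic_seq a -> forall k, (0 < a k)%N.
Proof. by case=> a0 alt _ [|k]; [rewrite a0|apply: leq_trans (alt k)]. Qed.

Lemma arith_dvd a : arithmetic_seq a -> forall j k, (j <= k)%N -> (a j %| a k)%N.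
Proof.
case=> _ _ adv j; elim=> [|k IH]; first by rewrite leqn0 => /eqP ->.
rewrite leq_eqVlt => /orP[/eqP -> //|]; rewrite ltnS => /IH h.
exact: dvdn_trans h (adv k).
Qed.

Lemma seq_ratioE a : arithmetic_seq a -> forall k, a k.+1 = (seq_ratio a k.+1 * a k)%N.
Proof. by case=> _ _ adv k; rewrite /seq_ratio divnK. Qed.

Lemma seq_ratio_gt1 a : arithmetic_seq a -> forall k, (1 < seq_ratio a k.+1)%N.
Proof.
move=> aa k; have := seq_ratioE aa k; case: aa => _ alt _.
have := alt k; case: (seq_ratio a k.+1) => [|[|r]] //; lia.
Qed.

Lemma associated_gap a k r m : arithmetic_seq a -> (0 < r)%N -> associated_set a m ->
  (r * a k < m < r.+1 * a k)%N -> False.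
Proof.
move=> aa r0 [j [s [/andP[s1 s2] ->]]] /andP[m1 m2].
case: (leqP k j) => kj.
  have /dvdnP[q qE] := arith_dvd aa kj; move: m1 m2; rewrite qE mulnA.
  rewrite !ltn_pmul2r ?(arith_gt0 aa) //; lia.
have h : (s * a j < a k)%N.
  apply: (@leq_trans (a j.+1)); last by apply: dvdn_leq; [exact: arith_gt0|exact: arith_dvd].
  by rewrite (seq_ratioE aa) ltn_pmul2r // arith_gt0.
nia.
Qed.

Lemma increasing_enum_next (S : set nat) d i x y : increasing_enum S d ->
  (0 < i)%N -> d i = x -> S y -> (x < y)%N -> (forall m, S m -> (x < m < y)%N -> False) ->
  d i.+1 = y.
Proof.
move=> [dinc dS] i0 dix Sy xy nb.
have [j /= j0 djy] : (d @` pos_nat) y by rewrite dS.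
have mono : forall p q, (0 < p)%N -> (p < q)%N -> (d p < d q)%N.
  by move=> p q p0 pq; apply: dinc => //; rewrite inE /pos_nat /=; lia.
have ij : (i < j)%N.
  case: (ltngtP i j) => // [ji|ij]; last by subst; lia.
  have := mono _ _ j0 ji; lia.
move: ij; rewrite leq_eqVlt => /orP[/eqP -> //|ij].
exfalso; apply: (nb (d i.+1)); first by rewrite -dS; exists i.+1.
by rewrite -djy mono // -dix mono.
Qed.

Lemma associated_seq1 a d : arithmetic_seq a -> associated_seq a d -> d 1%N = 1%N.
Proof.
move=> aa [dinc dS]; have h : associated_set a 1%N.
  exists 0%N, 1%N; rewrite seq_ratio_gt1 //; case: aa => -> _ _ //.
move: (h); rewrite -dS => -[j /= j0 dj].
have d1 : (0 < d 1)%N.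
  have : associated_set a (d 1%N) by rewrite -dS; exists 1%N.
  by move=> [k [r [/andP[r1 _] ->]]]; rewrite muln_gt0 r1 arith_gt0.
case: (ltngtP j 1) => [jl||e] ; [by move: jl j0; rewrite ltnS leqn0 => /eqP ->| |by rewrite -{1}e].
move=> j1; have : (d 1 < d j)%N by apply: dinc => //; rewrite inE /pos_nat /=; lia.
lia.
Qed.

Lemma associated_seq_idx a d : arithmetic_seq a -> associated_seq a d ->
  forall k r, (1 <= r < seq_ratio a k.+1)%N -> d (assoc_idx a k + r.-1)%N = (r * a k)%N.
Proof.
move=> aa da.
have step k : d (assoc_idx a k) = a k -> forall r, (1 <= r <= seq_ratio a k.+1)%N ->
    d (assoc_idx a k + r.-1)%N = (r * a k)%N.
  move=> dk; elim=> [//|[|r] IH] /= hr; first by rewrite addn0 mul1n.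
  rewrite addnS; apply: (increasing_enum_next da) (IH _) _ _ _.
  - case: (k) => [|k'] /=; last by have := seq_ratio_gt1 aa k'; lia.
    by [].
  - lia.
  - move: hr => /=; rewrite leq_eqVlt => /orP[/eqP ->|hr].
      by rewrite -(seq_ratioE aa); exists k.+1, 1%N; rewrite mul1n seq_ratio_gt1.
    by exists k, r.+2; rewrite /= hr.
  - by rewrite ltn_pmul2r // arith_gt0.
  - by move=> m Sm; apply: associated_gap Sm.
have main k : d (assoc_idx a k) = a k.
  elim: k => [|k IH] /=; first by rewrite (associated_seq1 aa da); case: aa.
  rewrite (step _ IH); first by rewrite -(seq_ratioE aa). have := seq_ratio_gt1 aa k; lia.
move=> k r hr; apply: step => //; lia.
Qed.

Lemma associated_seq_exists a : arithmetic_seq a -> exists d, associated_seq a d.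
Proof.
move=> aa; pose S := associated_set a.
have inf n : exists m, (n < m)%N && (m \in S).
  exists (a n.+1); apply/andP; split.
    elim: n => [|n IH]; first exact: arith_gt0.
    by case: (aa) => _ alt _; apply: leq_ltn_trans IH (alt _).
  by rewrite inE; exists n.+1, 1%N; rewrite mul1n seq_ratio_gt1.
pose d := fix d n := if n is n'.+1 then ex_minn (inf (d n')) else 0%N.
have dS n : (d n < d n.+1)%N /\ S (d n.+1).
  by rewrite /=; case: ex_minnP => m /andP[h1]; rewrite inE => h2 _.
exists d; split.
  move=> i j _ _; elim: j => // j IH; rewrite ltnS leq_eqVlt => /orP[/eqP ->|/IH].
    by case: (dS j).
  by move/ltn_trans; apply; case: (dS j).
apply/seteqP; split => [_ [[//|n] _ <-]|m Sm]; first by case: (dS n).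
have m0 : (0 < m)%N by case: Sm => k [r [/andP[r1 _] ->]]; rewrite muln_gt0 r1 arith_gt0.
have ub : forall n, (n <= d n)%N.
  elim=> // n IH; case: (dS n); lia.
have : exists n, (m <= d n)%N by exists m; apply: ub.
move=> /ex_minnP[[|n]]; first by rewrite /=; lia.
move=> h1 h2; exists n.+1 => //.
apply/eqP; rewrite eqn_leq h1 andbT /=; case: ex_minnP => q _; apply.
apply/andP; split; last by rewrite inE.
by case: (ltnP (d n) m) => // /h2; rewrite ltnn.
Qed.

End associated_seq_facts.

Definition lifting (a : nat -> nat) (A : set nat) : set nat :=
  \bigcup_(k in A) [set i | (assoc_idx a k.-1 <= i <= (assoc_idx a k).-1)%N].

Definition weakly_dense_dli (R : realType) (a : nat -> nat) : Prop :=
  forall K : set nat, K `<=` pos_nat -> infinite_set K ->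
  exists A : set nat, [/\ A `<=` K, infinite_set A &
    forall m, has_density (lifting a (shift_down A m)) (0 : R)].

(* Indexing [u] from 0 instead of 1 is immaterial for the limit. *)
Definition t_sub (R : realType) (u : nat -> int) : set (circle R) :=
  [set x | x *~ u n @[n --> \oo] --> (0 : circle R)].

Definition ts_sub (R : realType) (u : nat -> int) : set (circle R) :=
  [set x | forall eps : R, 0 < eps ->
     has_density [set n | pos_nat n /\ eps <= dist_int (x *~ u n)] (0 : R)].

Definition characterized (R : realType) (H : set (circle R)) : Prop :=
  exists u : nat -> int, H = t_sub u.

(* Main.v *)
(** Suppose the subgroup equals t_(u).  It contains every 1 / a_k, so each a_k
divides u_n for large n.  It is not the whole circle, hence u_n <> 0 infinitely
often.  For such n let a_k be the last term dividing u_n: a suitable digit e at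
position k + 1 keeps u_n e / a_(k+1) at distance at least 1/4 from the integers.
Choosing such positions so sparsely that the later digits contribute at most 1/8,
any x whose digits are supported on an infinite subset A of them satisfies
||u_n x|| >= 1/8 infinitely often.  The dli hypothesis provides such an A with
d(L(A - m)) = 0 for all m, which puts x in the statistical subgroup: an index i in
the block of a_k with ||d_i x|| not small has a nonzero digit shortly after
position k. *)

Require Import Defs.
From mathcomp Require Import all_boot all_order all_algebra.
From mathcomp Require Import all_classical all_reals all_analysis.
From mathcomp Require Import zify ring lra.

Import Order.TTheory GRing.Theory Num.Theory.
Import numFieldNormedType.Exports.

Local Open Scope classical_set_scope.
Local Open Scope ring_scope.

(** * Distance to the integers and convergence on the circle *)

Lemma dist_int_pi_lt (R : realType) (x e : R) :
  dist_int (\pi_(circle R)%qT x) < e <-> exists m : int, `|x - m%:~R| < e.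
Proof.
rewrite dist_int_pi; split.
  move=> /inf_lt[|_ [m _ <-] h]; last by exists m.
  by exists `|x - 0%:~R|; exists 0.
move=> [m]; apply: le_lt_trans; apply: ge_inf; last by exists m.
by exists 0 => _ [n _ <-]; exact: normr_ge0.
Qed.

Lemma pi_mulrz (R : realType) (x : R) (n : int) :
  (\pi_(circle R)%qT x) *~ n = \pi_(circle R)%qT (x * n%:~R).
Proof. by rewrite mulrzr -(raddfMz \pi_(circle R)%qT). Qed.

(** The set [dist_int y < e] is an open neighbourhood of 0: it pulls back to the union of the balls
    of radius e around the integers. *)
Lemma t_sub_near (R : realType) (u : nat -> int) (x e : R) : 0 < e ->
  t_sub u (\pi_(circle R)%qT x) ->
  \forall n \near \oo, exists m : int, `|x * (u n)%:~R - m%:~R| < e.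
Proof.
move=> e0 cvx; pose U := [set y : circle R | dist_int y < e].
suff Unbhs : nbhs (0 : circle R) U.
  have : \forall n \near \oo, U (\pi_(circle R)%qT x *~ u n) by exact: cvx.
  apply: filterS => n /=.
  by rewrite /U /= pi_mulrz dist_int_pi_lt.
apply: open_nbhs_nbhs; split; last first.
  rewrite /U /= -(raddf0 (\pi_(circle R)%qT)) dist_int_pi_lt.
  by exists 0; rewrite subrr normr0.
have -> : open U = circle_open U by [].
rewrite /circle_open.
have -> : (\pi_(circle R)%qT : R -> circle R) @^-1` U =
    \bigcup_(m : int) ball (m%:~R : R) e.
  apply/seteqP; split => [y|y [m _]].
    rewrite /U /= dist_int_pi_lt => -[m hm]; exists m => //.
    by rewrite /ball /= distrC.
  by rewrite /ball /= distrC => hm; rewrite /U /= dist_int_pi_lt; exists m.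
by apply: bigcup_open => m _; exact: ball_open.
Qed.

(** * Sets of density zero *)

Lemma card_predE (A : set nat) (n : nat) :
  #|[pred i : 'I_n | (i : nat) \in A]| = (\sum_(i < n) ((i : nat) \in A))%N.
Proof.
rewrite -sum1_card big_mkcond /=; apply: eq_bigr => i _.
by rewrite -[i \in _]/((i : nat) \in A); case: (_ \in A).
Qed.

Lemma has_density0_le (R : realType) (A : set nat) (f : nat -> nat) :
  (forall n, (#|[pred i : 'I_n | (i : nat) \in A]| <= f n)%N) ->
  (f n)%:R / n%:R @[n --> \oo] --> (0 : R) -> has_density A (0 : R).
Proof.
move=> Af f0; apply: squeeze_cvgr (cvg_cst (0 : R)) f0.
apply: nearW => n; rewrite divr_ge0 //= ler_wpM2r ?invr_ge0 // ler_nat; exact: Af.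
Qed.

Lemma has_density0S (R : realType) (A B : set nat) :
  A `<=` B -> has_density B (0 : R) -> has_density A (0 : R).
Proof.
move=> AB; apply: has_density0_le => n; rewrite !card_predE; apply: leq_sum => i _.
by have [/set_mem/AB/mem_set ->|] := boolP ((i : nat) \in A).
Qed.

Lemma has_density0_bounded (R : realType) (N : nat) : has_density `I_N (0 : R).
Proof.
apply: (@has_density0_le _ _ (fun=> N)) => [n|].
  suff -> : #|[pred i : 'I_n | (i : nat) \in `I_N]| = minn n N by exact: geq_minr.
  rewrite card_predE; elim: n => [|n IH]; first by rewrite big_ord0 min0n.
  rewrite big_ord_recr /= IH.
  have -> : (n \in `I_N) = (n < N)%N by apply/idP/idP; rewrite inE.
  lia.
rewrite -[0](mulr0 (N%:R : R)); apply: cvgM; first exact: cvg_cst.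
by rewrite -cvg_shiftS /=; exact: cvg_harmonic.
Qed.

Lemma has_density0U (R : realType) (A B : set nat) :
  has_density A (0 : R) -> has_density B (0 : R) -> has_density (A `|` B) (0 : R).
Proof.
move=> dA dB; apply: (@has_density0_le _ _ (fun n =>
  #|[pred i : 'I_n | (i : nat) \in A]| + #|[pred i : 'I_n | (i : nat) \in B]|))%N => [n|].
  rewrite !card_predE -big_split /=; apply: leq_sum => i _.
  by rewrite in_setU; case: (_ \in A); case: (_ \in B).
rewrite -[0]addr0; under eq_fun do rewrite natrD mulrDl; exact: cvgD.
Qed.

(** Each pair {2j + 1, 2j + 2} meets [A], so at least n of the indices up to 2n lie in [A]. *)
Lemma not_has_density0_pairs (R : realType) (A : set nat) :
  (forall i, (0 < i)%N -> A i \/ A i.+1) -> ~ has_density A (0 : R).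
Proof.
move=> Apair dA.
have cnt n : (n <= #|[pred i : 'I_n.*2.+1 | (i : nat) \in A]|)%N.
  rewrite card_predE; elim: n => // n IH; rewrite doubleS 2!big_ord_recr /=.
  suff : (0 < (n.*2.+1 \in A) + (n.*2.+2 \in A))%N.
    by move=> h; apply: leq_ltn_trans IH _; rewrite -addnA -[ltnLHS]addn0 ltn_add2l.
  by case: (Apair n.*2.+1) => // /mem_set ->; rewrite ?addn1.
have : \forall n \near \oo,
    #|[pred i : 'I_n | (i : nat) \in A]|%:R / n%:R < 1 / 3 :> R.
  by apply: (cvgr_lt _ dA); lra.
case=> N _ HN; have /= := HN (N.+1).*2.+1.
rewrite ltr_pdivrMr ?ltr0n // => /(_ _)/wrap[|]; first by lia.
apply/negP; rewrite -leNgt.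
apply: (@le_trans _ _ (N.+1%:R)); last by rewrite ler_nat.
by rewrite mul1r ler_pdivrMl // -natrM ler_nat; lia.
Qed.

(** * Expansions with respect to the ratios of [a] *)

Lemma arith_growth (a : nat -> nat) : arithmetic_seq a ->
  forall k m, (m.+1 * a k <= a (k + m))%N.
Proof.
move=> aa k; elim=> [|m IH]; first by rewrite mul1n addn0.
rewrite addnS (seq_ratioE aa).
have := seq_ratio_gt1 aa (k + m); have := arith_gt0 aa k; nia.
Qed.

(* th k in [0, 1] represents a_k x mod 1, where x = th 0 has the digits c. *)
Lemma digit_expansion (R : realType) (a c : nat -> nat) : arithmetic_seq a ->
  (forall k, (c k.+1 < seq_ratio a k.+1)%N) ->
  exists th : nat -> R, (forall k, 0 <= th k <= 1) /\
    (forall k, (seq_ratio a k.+1)%:R * th k = (c k.+1)%:R + th k.+1).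
Proof.
move=> aa cb; pose S n : R := \sum_(i < n) (c i.+1)%:R / (a i.+1)%:R.
have a0 k : 0 < (a k)%:R :> R by rewrite ltr0n arith_gt0.
have SS n : S n.+1 = S n + (c n.+1)%:R / (a n.+1)%:R by rewrite /S big_ord_recr.
have Smono m n : (m <= n)%N -> S m <= S n.
  by move: m n; apply/nondecreasing_seqP => k; rewrite SS lerDl divr_ge0.
(* Since each digit is at most its ratio minus 1, these upper bounds for the partial sums do not
   increase. *)
have Tmono m n : (m <= n)%N -> S n + (a n)%:R^-1 <= S m + (a m)%:R^-1.
  move: m n; apply/(nonincreasing_seqP (fun n => S n + (a n)%:R^-1)) => k.
  rewrite SS -addrA lerD2l -{2}[(a k.+1)%:R^-1]mul1r -mulrDl natr1.
  rewrite ler_pdivrMr // (seq_ratioE aa) natrM mulrC mulfK ?gt_eqF //.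
  by rewrite ler_nat cb.
have ST m n : S n <= S m + (a m)%:R^-1.
  apply: le_trans (Smono _ _ (leq_maxr m n)) _.
  by apply: le_trans (Tmono _ _ (leq_maxl m n)); rewrite lerDl invr_ge0 ltW.
pose x := sup (range S).
have Sx n : S n <= x.
  by apply: ub_le_sup; [exists (S 0%N + (a 0%N)%:R^-1) => _ [k _ <-]; exact: ST|exists n].
have xT n : x <= S n + (a n)%:R^-1.
  by apply: ge_sup => [|_ [k _ <-]]; [exists (S 0%N), 0%N|exact: ST].
(* The tail of the series for x after k digits, rescaled by a_k. *)
exists (fun k => (a k)%:R * (x - S k)); split=> k.
  apply/andP; split; first by apply: mulr_ge0; rewrite ?subr_ge0 // ltW.
  by rewrite -ler_pdivlMl // mulr1 lerBlDl.
rewrite SS mulrA -natrM -(seq_ratioE aa); field; rewrite gt_eqF //.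
Qed.

Lemma has_density0_exists (R : realType) (B : nat -> set nat) (m : nat) :
  (forall j, has_density (B j) (0 : R)) ->
  has_density [set i | exists2 j, (j < m)%N & B j i] (0 : R).
Proof.
move=> dB; elim: m => [|m IH].
  by apply: has_density0S (has_density0_bounded R 0) => i [].
apply: has_density0S (has_density0U _ _ _ IH (dB m)) => i [j].
rewrite ltnS leq_eqVlt => /orP[/eqP -> ?|jm Bj]; first by right.
by left; exists j.
Qed.

Lemma assoc_idx_decomp (a : nat -> nat) (i : nat) : arithmetic_seq a -> (0 < i)%N ->
  exists k r, (1 <= r < seq_ratio a k.+1)%N /\ i = (assoc_idx a k + r.-1)%N.
Proof.
move=> aa; elim: i => // -[_ _|i /(_ isT) [k [r [/andP[r1 rb] ->]]] _].
  by exists 0%N, 1%N; rewrite (seq_ratio_gt1 aa).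
have [rb'|br] := ltnP r.+1 (seq_ratio a k.+1).
  by exists k, r.+1; split=> //=; lia.
by exists k.+1, 1%N; rewrite (seq_ratio_gt1 aa) /=; split=> //; lia.
Qed.

Lemma int_away (R : realType) (t : R) (m : int) : 1 / 8 <= t <= 7 / 8 ->
  1 / 8 <= `|t - m%:~R|.
Proof.
move=> /andP[t1 t2]; rewrite ler_normr.
have [m0|m1] := leP m 0.
  have : m%:~R <= 0 :> R by rewrite lerz0.
  by move=> ?; apply/orP; left; lra.
have : 1 <= m%:~R :> R by rewrite ler1z -gtz0_ge1.
by move=> ?; apply/orP; right; lra.
Qed.

(** * Multiples of a point read off from its digits *)

Section digits.
Variables (R : realType) (a c : nat -> nat) (th : nat -> R).
Hypothesis aa : arithmetic_seq a.
Hypothesis th01 : forall k, 0 <= th k <= 1.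
Hypothesis thS : forall k, (seq_ratio a k.+1)%:R * th k = (c k.+1)%:R + th k.+1.

Lemma digits_mul k : exists z : int, (a k)%:R * th 0%N = z%:~R + th k.
Proof.
elim: k => [|k [z IH]]; first by exists 0; case: (aa) => -> _ _; rewrite mul1r add0r.
exists (Posz (c k.+1) + Posz (seq_ratio a k.+1) * z).
rewrite (seq_ratioE aa) natrM -mulrA IH mulrDr thS intrD intrM -!pmulrn; ring.
Qed.

(** The m zero digits give a_(k+m) th_k = a_k th_(k+m) <= a_k, while a_(k+m) >= (m + 1) a_k. *)
Lemma digits_gap k m : (forall j, (j < m)%N -> c (k + j).+1 = 0%N) ->
  (m.+1)%:R * th k <= 1.
Proof.
move=> c0; suff E : (a (k + m))%:R * th k = (a k)%:R * th (k + m)%N.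
  have ak0 : 0 < (a k)%:R :> R by rewrite ltr0n arith_gt0.
  have /andP[t0 _] := th01 k; have /andP[_ t1] := th01 (k + m)%N.
  rewrite -(ler_pM2l ak0) mulrA -natrM mulr1.
  apply: (@le_trans _ _ ((a (k + m))%:R * th k)).
    by rewrite ler_wpM2r // ler_nat mulnC arith_growth.
  by rewrite E ler_piMr // ltW.
elim: m c0 => [|m IH] c0; first by rewrite addn0.
rewrite addnS (seq_ratioE aa) natrM -mulrA IH => [|j jm]; last by apply: c0; lia.
by rewrite mulrCA thS c0 // add0r.
Qed.

(** With 1 / (m + 1) < eps, every i with ||d_i x|| >= eps lies in some L(A - j), j <= m: if the m +
    1 digits after position k vanish, then d_i x is r th_k mod 1, and r th_k <= b th_k = th_(k+1) <=
    1 / (m + 1). *)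
Lemma ts_sub_digits (d : nat -> nat) (A : set nat) : associated_seq a d ->
  (forall m, has_density (lifting a (shift_down A m)) (0 : R)) ->
  (forall k, c k.+1 <> 0%N -> A k.+1) ->
  ts_sub (fun n => Posz (d n)) (\pi_(circle R)%qT (th 0%N)).
Proof.
move=> da dA cA eps eps0.
have [m meps] : exists m, (m.+1)%:R^-1 < eps.
  have : \forall m \near \oo, harmonic m < eps by apply: (cvgr_lt _ cvg_harmonic).
  by case=> m _ /(_ m (leqnn m)) ?; exists m.
apply: has_density0S (has_density0_exists _ _ m.+1 dA) => i [i0]; rewrite leNgt.
move=> /negP far; apply: contrapT => good; apply: far.
have [k [r [/andP[r1 rb] iE]]] := assoc_idx_decomp _ _ aa i0.
have c0 j : (j < m.+1)%N -> c (k + j).+1 = 0%N.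
  move=> jm; apply: contrapT => /cA Akj; apply: good; exists j => //.
  (* In [lifting], the block of a_k carries the index k + 1. *)
  exists k.+1; first by split => //; rewrite addSn.
  by rewrite /= iE; lia.
rewrite iE (associated_seq_idx aa da) ?r1 // pi_mulrz dist_int_pi_lt.
have [z Ez] := digits_mul k.
exists (Posz r * z).
have -> : th 0%N * (Posz (r * a k))%:~R - (Posz r * z)%:~R = r%:R * th k.
  by rewrite -pmulrn natrM intrM -pmulrn mulrCA [th 0%N * _]mulrC Ez; ring.
have /andP[t0 _] := th01 k.
rewrite ger0_norm ?mulr_ge0 //; apply: le_lt_trans meps.
have gap : m.+1%:R * th k.+1 <= 1.
  by apply: digits_gap => j jm; rewrite addSn -addnS c0.
rewrite -[leRHS]mul1r ler_pdivlMr // mulrC.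
apply: le_trans gap; rewrite ler_wpM2l //.
have := c0 0%N isT; rewrite addn0 => ck0.
have := thS k; rewrite ck0 add0r => <-.
by rewrite ler_wpM2r // ler_nat ltnW.
Qed.

(* Since d_(i+1) - d_i = a_k on the block of a_k, the points d_i x and d_(i+1) x
   are not both near 0. *)
Lemma not_ts_sub_digits (d : nat -> nat) : associated_seq a d ->
  (forall k, 1 / 8 <= th k <= 7 / 8) ->
  ~ ts_sub (fun n => Posz (d n)) (\pi_(circle R)%qT (th 0%N)).
Proof.
(* Two errors below 1/16 would put a_k x within 1/8 of an integer, against the bounds on [th k]. *)
move=> da thb /(_ (1 / 16)) /(_ _)/wrap[]; first by lra.
apply: not_has_density0_pairs => i i0; apply: contrapT => /not_orP[].
have [k [r [/andP[r1 rb] iE]]] := assoc_idx_decomp _ _ aa i0.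
have dS : d i.+1 = (d i + a k)%N.
  rewrite iE (associated_seq_idx aa da) ?r1 // -mulSnr.
  have [rb'|br] := ltnP r.+1 (seq_ratio a k.+1).
    rewrite -(associated_seq_idx aa da (r := r.+1)) ?rb' //; congr d; lia.
  have -> : r.+1 = seq_ratio a k.+1 by lia.
  rewrite -(seq_ratioE aa) -[RHS]mul1n.
  rewrite -(associated_seq_idx aa da) ?(seq_ratio_gt1 aa) //; congr d => /=; lia.
move=> n1 n2.
have near j : (0 < j)%N -> ~ (pos_nat j /\
    1 / 16 <= dist_int (\pi_(circle R)%qT (th 0%N) *~ Posz (d j))) ->
    exists m : int, `|th 0%N * (d j)%:R - m%:~R| < 1 / 16.
  move=> j0 nj; apply/dist_int_pi_lt; rewrite [(d j)%:R]pmulrn -pi_mulrz ltNge.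
  by apply/negP => h; apply: nj.
have [m1] := near _ i0 n1; have [m2] := near _ (ltn0Sn i) n2.
have [z] := digits_mul k.
rewrite dS natrD mulrDr [_ * (a k)%:R]mulrC => -> h2 h1.
have := int_away _ _ (m2 - m1 - z) (thb k); rewrite !intrB.
move: h1 h2; rewrite !ltr_norml !ler_normr => /andP[? ?] /andP[? ?] /orP[]; lra.
Qed.

(** Modulo 1, u x is v th_k = (v c_(k+1) + v th_(k+1)) / b. Here v c_(k+1) / b is at least 1/4 away
    from the integers, and |v| <= |u| with the 8 |u| zero digits bounds |v th_(k+1)| by 1/8. *)
Lemma digits_far (k : nat) (u v z : int) : u = v * Posz (a k) ->
  Posz (seq_ratio a k.+1) <= 4 * (Posz (c k.+1) * v - z * Posz (seq_ratio a k.+1))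
    <= 3 * Posz (seq_ratio a k.+1) ->
  (forall j, (j < 8 * `|u|)%N -> c (k.+1 + j).+1 = 0%N) ->
  forall m : int, 1 / 8 <= `|th 0%N * u%:~R - m%:~R|.
Proof.
move=> uE quarter c0 m; have [z' Ez] := digits_mul k.
have gap := digits_gap _ _ c0; have /andP[t0 t1] := th01 k.+1.
have vu : (`|v| <= `|u|)%N by rewrite uE abszM leq_pmulr // arith_gt0.
have vth : `|v%:~R * th k.+1| <= 1 / 8.
  rewrite normrM (ger0_norm t0) -intr_norm -abszE -pmulrn.
  have : (8 * `|v|)%:R * th k.+1 <= 1.
    by apply: le_trans gap; rewrite ler_wpM2r // ler_nat; lia.
  by rewrite natrM; lra.
have := thS k; move: (seq_ratio_gt1 aa k) quarter; set b := seq_ratio a k.+1.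
move=> b1; rewrite -!(ler_int R) => quarter E.
have -> : th 0%N * u%:~R - m%:~R = (v%:~R * th k - z%:~R) - (m - z - v * z')%:~R.
  by rewrite uE !intrB !intrM -pmulrn mulrCA [th 0%N * _]mulrC Ez; ring.
apply: int_away.
have b1' : 1 <= b%:R :> R by rewrite ler1n; lia.
have b0 : 0 < b%:R :> R by lra.
have bt : b%:R * (v%:~R * th k - z%:~R) =
    (c k.+1)%:R * v%:~R - z%:~R * b%:R + v%:~R * th k.+1.
  by rewrite mulrBr mulrCA E; ring.
rewrite -(ler_pM2l b0) -[in X in _ && X](ler_pM2l b0) bt.
move: quarter vth; rewrite !intrM !intrB !intrM -!pmulrn ler_norml.
by move=> /andP[q1 q2] /andP[n1 n2]; apply/andP; split; lra.
Qed.

End digits.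

(** Digits near half the ratio keep every [th k] in [1/8, 7/8]. This rules out a sequence [u] that
    is eventually 0. *)
Lemma exists_not_ts_sub (R : realType) (a d : nat -> nat) : arithmetic_seq a ->
  associated_seq a d ->
  exists x : circle R, ~ ts_sub (fun n => Posz (d n)) x.
Proof.
move=> aa da.
(* For ratio 2 the digit alternates: a constant digit 1 would give an integer. *)
pose c k := if seq_ratio a k == 2 then nat_of_bool (odd k) else (seq_ratio a k)./2.
have cb k : (c k.+1 < seq_ratio a k.+1)%N.
  have := seq_ratio_gt1 aa k; rewrite /c; case: eqP => [->|]; last by lia.
  by case: odd.
have [th [th01 thS]] := digit_expansion R _ _ aa cb.
exists (\pi_(circle R)%qT (th 0%N)); apply: (not_ts_sub_digits _ _ _ _ aa thS _ da).
have big k : seq_ratio a k.+1 <> 2 -> 1 / 3 <= th k <= 3 / 4.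
  move=> b2; have b3 : (2 < seq_ratio a k.+1)%N by have := seq_ratio_gt1 aa k; lia.
  have := thS k; rewrite /c; case: eqP => // _.
  move: (th01 k.+1) b3; set b := seq_ratio a k.+1 => /andP[t0 t1] b3 E.
  have b0 : 0 < b%:R :> R by rewrite ltr0n; lia.
  have l : (b <= 3 * b./2)%N by lia.
  have u : (4 * (b./2).+1 <= 3 * b)%N by lia.
  move: l u; rewrite -!(ler_nat R) !natrM -[b./2.+1%:R]natr1 => l u.
  rewrite -(ler_pM2l b0) -[in X in _ && X](ler_pM2l b0) E.
  by apply/andP; split; lra.
have small k : seq_ratio a k.+1 = 2 -> 2 * th k = (odd k.+1)%:R + th k.+1.
  by move=> b2; have := thS k; rewrite b2 /c b2 eqxx.
have half k : seq_ratio a k.+1 = 2 -> if odd k.+1 then 1 / 2 <= th k else th k <= 1 / 2.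
  move/small; have /andP[t0 t1] := th01 k.+1.
  by case: odd => /=; lra.
move=> k; have [/small E|/big] := pselect (seq_ratio a k.+1 = 2); last by lra.
(* Here th_k is half of digit + th_(k+1). If the next ratio is 2, th_(k+1) lies in the opposite half
   of [0, 1]; otherwise it lies in [1/3, 3/4], and the extreme case is (1 + 3/4) / 2 = 7/8. *)
have [/half|/big] := pselect (seq_ratio a k.+2 = 2); move: E (th01 k.+1) => /=;
  by case: odd => /=; lra.
Qed.

(** * Choice of a digit and of its position *)

Lemma quarter_multiple_nat (b w : nat) : (0 < w)%N -> (2 * w <= b)%N ->
  exists2 c, (c < b)%N & (b <= 4 * (c * w) <= 3 * b)%N.
Proof.
move=> w0 wb.
(* For the least such c, 4 c w exceeds b by less than 4 w <= 2 b. *)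
have ex : exists c, (b <= 4 * (c * w))%N by exists b; nia.
have [c bc cmin] := ex_minnP ex.
have c0 : (0 < c)%N by case: c bc {cmin} => //; lia.
have lt : (4 * (c.-1 * w) < b)%N.
  by rewrite ltnNge; apply/negP => /cmin; lia.
exists c; nia.
Qed.

(* Some multiple of a nonzero element of Z/b stays at distance at least 1/4
   from 0 in R/Z: take the first multiple of the representative w or b - w
   lying in [0, b/2] that passes b/4. *)
Lemma quarter_multiple (b : nat) (v : int) : (0 < b)%N -> ~~ (Posz b %| v)%Z ->
  exists (c : nat) (z : int), [/\ (0 < c)%N, (c < b)%N &
    Posz b <= 4 * (Posz c * v - z * Posz b) <= 3 * Posz b].
Proof.
move=> b0 bv.
have b0' : Posz b != 0 by rewrite eqz_nat; lia.
pose w := `|(v %% Posz b)%Z|%N.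
have wE : Posz w = (v %% Posz b)%Z by rewrite /w gez0_abs // modz_ge0.
have w0 : (0 < w)%N.
  by rewrite lt0n -eqz_nat wE; apply: contra bv => /eqP/dvdz_mod0P.
have wb : (w < b)%N by rewrite -ltz_nat wE ltz_pmod.
have vE : v = (v %/ Posz b)%Z * Posz b + Posz w by rewrite wE -divz_eq.
have [w2|w2] := leqP (2 * w) b.
  have [c cb /andP[h1 h2]] := quarter_multiple_nat _ _ w0 w2.
  exists c, (Posz c * (v %/ Posz b)%Z); split=> //; first by nia.
  have -> : Posz c * v - Posz c * (v %/ b)%Z * Posz b = Posz (c * w).
    by rewrite {1}vE PoszM; ring.
  lia.
have w0' : (0 < b - w)%N by lia.
have w2' : (2 * (b - w) <= b)%N by lia.
have [c cb /andP[h1 h2]] := quarter_multiple_nat _ _ w0' w2'.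
(* Now c v is -c (b - w) mod b, and the interval [b/4, 3b/4] is symmetric under t -> b - t. *)
exists c, (Posz c * (v %/ Posz b)%Z + Posz c - 1); split=> //; first by nia.
have -> : Posz c * v - (Posz c * (v %/ b)%Z + Posz c - 1) * Posz b =
    Posz b - Posz (c * (b - w)).
  by rewrite {1}vE PoszM -subzn; [ring|lia].
lia.
Qed.

Lemma critical_level (a : nat -> nat) (u : int) (l : nat) : arithmetic_seq a ->
  u != 0 -> (Posz (a l) %| u)%Z ->
  exists k v, [/\ (l <= k)%N, u = v * Posz (a k) & ~~ (Posz (seq_ratio a k.+1) %| v)%Z].
Proof.
move=> aa u0 lu.
have bnd i : (Posz (a i) %| u)%Z -> (i <= `|u|)%N.
  move=> iu; have : (a i <= `|u|)%N by apply: dvdn_leq; [rewrite absz_gt0|exact: iu].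
  have := arith_growth a aa 0 i; have := arith_gt0 aa 0; rewrite add0n; nia.
have ex : exists i, (Posz (a i) %| u)%Z by exists l.
(* The largest k with a_k dividing u, which exists since a_i > i and u is nonzero. *)
have [k ku kmax] := ex_maxnP ex bnd.
have [v uE] := dvdzP ku; exists k, v; split=> //; first exact: kmax.
apply/negP => /dvdzP[q vE]; have /kmax : (Posz (a k.+1) %| u)%Z; last by rewrite ltnn.
by apply/dvdzP; exists q; rewrite (seq_ratioE aa) PoszM mulrA -vE.
Qed.

(** From index n_k on, every d_i is a multiple of a_k, so only finitely many indices are
    exceptional. *)
Lemma ts_sub_inv (R : realType) (a d : nat -> nat) (k : nat) : arithmetic_seq a ->
  associated_seq a d ->
  ts_sub (fun n => Posz (d n)) (\pi_(circle R)%qT (a k)%:R^-1).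
Proof.
move=> aa da eps eps0.
apply: has_density0S (has_density0_bounded R (assoc_idx a k)) => i [i0 /=].
rewrite leNgt => /negP far; rewrite ltnNge; apply/negP => ki; apply: far.
have [j [r [/andP[r1 rb] iE]]] := assoc_idx_decomp _ _ aa i0.
have kj : (k <= j)%N.
  rewrite leqNgt; apply/negP => jk.
  have monoS n : (assoc_idx a n <= assoc_idx a n.+1)%N by exact: leq_addr.
  have /= := homo_leq (r := fun m n => (m <= n)%N) leqnn leq_trans monoS jk.
  by lia.
have [q qE] := dvdnP (arith_dvd aa kj).
have ak0 : (a k)%:R != 0 :> R by rewrite pnatr_eq0 -lt0n arith_gt0.
rewrite iE (associated_seq_idx aa da) ?r1 // pi_mulrz dist_int_pi_lt.
exists (Posz (r * q)); rewrite qE mulnA -!pmulrn [in X in X - _]natrM mulrC mulfK //.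
by rewrite subrr normr0.
Qed.

(** A multiple of 1 / q at distance less than 1 / q from an integer is that integer. *)
Lemma near_dvd_of_inv (R : realType) (u : nat -> int) (q : nat) : (0 < q)%N ->
  t_sub u (\pi_(circle R)%qT q%:R^-1) -> \forall n \near \oo, (Posz q %| u n)%Z.
Proof.
move=> q0; have q0' : 0 < q%:R :> R by rewrite ltr0n.
have qV0 : 0 < q%:R^-1 :> R by rewrite invr_gt0.
move=> /(t_sub_near _ _ _ _ qV0); apply: filterS => n [m].
have -> : q%:R^-1 * (u n)%:~R - m%:~R = q%:R^-1 * (u n - m * Posz q)%:~R :> R.
  rewrite intrB intrM -pmulrn; field; exact: lt0r_neq0.
rewrite normrM (ger0_norm (ltW qV0)) -[ltRHS]mulr1 ltr_pM2l // -intr_norm.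
rewrite -[1]/(1%:~R) ltr_int => h; apply/dvdzP; exists m; lia.
Qed.

(** * Sparse critical positions and the contradiction *)

Theorem theorem3p24 (R : realType) (a d : nat -> nat)
  (a_arith : arithmetic_seq a) (a_dli : weakly_dense_dli R a)
  (d_assoc : associated_seq a d) :
  ~ characterized (@ts_sub R (fun n => Posz (d n))).
Proof.
move=> [u tsE].
have ts_t x : ts_sub (fun n => Posz (d n)) x -> @t_sub R u x by rewrite tsE.
have [u0|unz] := pselect (\forall n \near \oo, u n = 0).
  have [x] := exists_not_ts_sub R a d a_arith d_assoc; apply; rewrite tsE.
  by apply: cvg_near_cst; apply: filterS u0 => n ->; rewrite mulr0z.
have unz' N : exists2 n, (N <= n)%N & u n != 0.
  apply: contrapT => no; apply: unz; exists N => // n /= Nn.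
  by apply/eqP; apply: contrapT => /negP un; apply: no; exists n.
(* The bounds say that u_n e / a_(k+1) = e v / b stays at least 1/4 away from the integers. *)
pose critical l (q : nat * nat * nat) := let: (k, n, e) := q in
  [/\ (l <= k)%N, (l <= n)%N, (e < seq_ratio a k.+1)%N & exists v z,
    u n = v * Posz (a k) /\ Posz (seq_ratio a k.+1) <=
    4 * (Posz e * v - z * Posz (seq_ratio a k.+1)) <= 3 * Posz (seq_ratio a k.+1)].
have ex_critical l : exists q, critical l q.
  have [N _ uN] := near_dvd_of_inv R u (a l) (arith_gt0 a_arith l)
    (ts_t _ (ts_sub_inv R a d l a_arith d_assoc)).
  have [n nN un] := unz' (maxn N l).
  have /uN dvd : (N <= n)%N by lia.
  have [k [v [lk uE ndvd]]] := critical_level _ _ _ a_arith un dvd.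
  have [|e [z [e0 eb quarter]]] := quarter_multiple _ _ _ ndvd.
    by have := seq_ratio_gt1 a_arith k; lia.
  by exists (k, n, e); split=> //; [lia|exists v, z].
have [F FP] := choice ex_critical.
(* Leaves room for the run of zero digits that [digits_far] requires. *)
pose next l := ((F l).1.1.+1 + 8 * `|u (F l).1.2|)%N.
pose lev j := iter j next 0%N.
pose kk j := (F (lev j)).1.1; pose nn j := (F (lev j)).1.2.
pose p j := (kk j).+1.
have levS j : lev j.+1 = (p j + 8 * `|u (nn j)|)%N by [].
have spec j : critical (lev j) (kk j, nn j, (F (lev j)).2).
  by have := FP (lev j); rewrite /kk /nn; case: (F (lev j)) => [[]].
have levSS n : (lev n <= lev n.+1)%N by have [h _ _ _] := spec n; rewrite levS /p; lia.
have lev_mono := homo_leq (r := fun m n => (m <= n)%N) leqnn leq_trans levSS.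
have lev_ge j : (j <= lev j)%N.
  by elim: j => // j IH; have [h _ _ _] := spec j; rewrite levS /p; lia.
have p_gap i j : (i < j)%N -> (p i + 8 * `|u (nn i)| < p j)%N.
  move=> ij; have : (lev i.+1 <= lev j)%N by exact: lev_mono.
  rewrite levS.
  by have [h _ _ _] := spec j; rewrite /p in h *; lia.
have p_inj i j : p i = p j -> i = j.
  by move=> e; case: (ltngtP i j) => // /p_gap; lia.
have [||A [Ap Ainf Adens]] := a_dli (range p).
- by move=> _ [j _ <-].
- move=> fin; apply: infinite_nat; rewrite -(preimage_range p).
  by apply: finite_preimage fin => i j _ _; exact: p_inj.
(* The default 0 is harmless: [digit] uses [ind] only on [A], inside the range of [p]. *)
pose ind x := xget 0%N [set j | p j = x].
have indp j : ind (p j) = j.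
  by rewrite /ind; case: xgetP => [i _ /p_inj //|/(_ j)]; case.
pose digit x := if pselect (A x) then (F (lev (ind x))).2 else 0%N.
have digitA x : digit x <> 0%N -> A x by rewrite /digit; case: pselect.
have digit_lt k : (digit k.+1 < seq_ratio a k.+1)%N.
  rewrite /digit; case: pselect => [Ak|_] /=.
    by have [j _ pj] := Ap _ Ak; rewrite -pj indp; have [_ _] := spec j.
  by have := seq_ratio_gt1 a_arith k; lia.
have [th [th01 thS]] := digit_expansion R _ _ a_arith digit_lt.
pose x := \pi_(circle R)%qT (th 0%N).
have : t_sub u x.
  apply: ts_t.
  by apply: (ts_sub_digits _ _ _ _ a_arith th01 thS _ _ d_assoc Adens) => k; exact: digitA.
have e8 : 0 < 1 / 8 :> R by lra.
move=> /(t_sub_near _ _ _ _ e8)[N _ uN].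
have [j Nj Apj] : exists2 j, (N <= j)%N & A (p j).
  apply: contrapT => no; apply: Ainf.
  apply: sub_finite_set (finite_image p (finite_II N)) => y Ay.
  have [j _ pj] := Ap _ Ay; exists j => //=; rewrite ltnNge; apply/negP => Nj.
  by apply: no; exists j; rewrite ?pj.
have [_ ln _ [v [z [uE quarter]]]] := spec j.
have [|m] := uN (nn j); first by have := lev_ge j; rewrite /=; lia.
apply/negP; rewrite -leNgt.
apply: (digits_far _ _ _ _ a_arith th01 thS (kk j) _ _ z uE) => [|i iu].
  rewrite /digit; case: pselect => [_|/(_ Apj)//] /=.
  by rewrite -[(kk j).+1]/(p j) indp.
(* No position falls in the window after p j: by [p_gap], earlier ones lie below p j and later ones
   beyond p j + 8 |u_n|, with n = [nn j]. *)
apply: contrapT => /digitA/Ap[i' _ pi'].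
case: (ltngtP i' j) => [/p_gap|/p_gap|ij].
- by rewrite pi' /p; lia.
- by rewrite pi' /p; lia.
- by move: pi'; rewrite ij /p; lia.
Qed.
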